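(* Let $M$ be a closed term. For each tight typing $\vdash^{w}M:\mathtt{b}$ there exists $k\in\mathbb{N}$ such that $\|\mathtt{b}\|\le\mathcal{P}_k(M)$ and $w\le\mathcal{E}_k(M)$.
   Context: Terms: values $V ::= x \mid \lambda x.M$; terms $M ::= V \mid VV \mid M\oplus M \mid \mathtt{let}\ x = M\ \mathtt{in}\ M$; $M\{V/x\}$ is capture-avoiding substitution. A multidistribution on terms is a finite multiset $\langle p_iM_i\rangle_{i\in I}$ with $p_i\in(0,1]$, $\sum_ip_i\le1$; $\sqcup$ is multiset union and $q\cdot\langle p_iM_i\rangle=\langle (qp_i)M_i\rangle$. One-step reduction: $(\lambda x.M)V\to\langle 1\,M\{V/x\}\rangle$; $\mathtt{let}\ x=V\ \mathtt{in}\ M\to\langle 1\,M\{V/x\}\rangle$; $M\oplus N\to\langle\tfrac12 M,\tfrac12 N\rangle$; if $N\to\langle p_iN_i\rangle_{i\in I}$ then $\mathtt{let}\ x=N\ \mathtt{in}\ M\to\langle p_i(\mathtt{let}\ x=N_i\ \mathtt{in}\ M)\rangle_{i\in I}$. (Closed terms that do not reduce are exactly values.) Lifting to multidistributions of closed terms: $\langle p_iM_i\rangle_{i\in I}\Rightarrow\bigsqcup_i p_i\cdot\mathbf{m}_i$ where $\mathbf{m}_i=\langle 1M_i\rangle$ if $M_i$ is a value and $M_i\to\mathbf{m}_i$ otherwise. For closed $M$ let $\langle 1M\rangle=\mathbf{m}_0\Rightarrow\mathbf{m}_1\Rightarrow\cdots$; $\mathcal{P}_k(M)$ is the sum of the probabilities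 of the values occurring in $\mathbf{m}_k$, and $\mathcal{E}_k(M)=\sum_{j=0}^{k-1}(1-\mathcal{P}_j(M))$. Types: arrow types $\mathtt{A} ::= \mathcal{M}\to \mathtt{a}$; intersection types $\mathcal{M} ::= [q_1\cdot \mathtt{A}_1,\dots,q_n\cdot\mathtt{A}_n]$ ($n\ge0$, scale factors $q_i\in(0,1]\cap\mathbb{Q}$); type distributions $\mathtt{a} ::= \langle p_1\mathcal{M}_1,\dots,p_n\mathcal{M}_n\rangle$ ($n\ge0$, $p_i\in(0,1]$, $\sum p_i\le1$), with norm $\|\mathtt{a}\|=\sum_i p_i$; $\mathbf{0}$ is the empty type distribution. Scaling: $u\cdot[q_i\cdot\mathtt{A}_i]_i=[(uq_i)\cdot \mathtt{A}_i]_i$, $u\cdot\langle p_i\mathcal{M}_i\rangle_i=\langle (up_i)\mathcal{M}_i\rangle_i$; $\uplus,\sqcup$ multiset unions. Typing contexts map variables to intersection types (finitely many nonempty), pointwise $\uplus$ and scaling. Rules for $\Gamma\vdash^{w}M:\tau$ ($w\in\mathbb{Q}$): (Var) $x:\mathcal{M}\vdash^0 x:\mathcal{M}$. (Zero) $\vdash^0 M:\mathbf{0}$. (@) from $\Gamma\vdash^{w}V:[1\cdot(\mathcal{M}\to\mathtt{b})]$, $\Delta\vdash^{v}W:\mathcal{M}$ infer $\Gamma\uplus\Delta\vdash^{w+v}VW:\mathtt{b}$. ($\oplus$) from $\Gamma\vdash^{w}M:\mathtt{a}$, $\Delta\vdash^{v}N:\mathtt{b}$ infer $\tfrac12\cdot\Gamma\uplus\tfrac12\cdot\Delta\vdash^{\frac12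 w+\frac12 v+1}M\oplus N:\tfrac12\mathtt{a}\sqcup\tfrac12\mathtt{b}$. ($\lambda$) from $\Gamma,x:\mathcal{M}\vdash^{w}M:\mathtt{b}$ infer $\Gamma\vdash^{w+1}\lambda x.M:\mathcal{M}\to\mathtt{b}$. (let) from $\Gamma\vdash^{v}N:\langle p_k\mathcal{M}_k\rangle_{k\in K}$ and $\Delta_k,x:\mathcal{M}_k\vdash^{w_k}M:\mathtt{b}_k$ ($k\in K$) infer $\Gamma\uplus_{k}p_k\cdot\Delta_k\vdash^{\sum_k p_kw_k+v+1}\mathtt{let}\ x=N\ \mathtt{in}\ M:\bigsqcup_k p_k\mathtt{b}_k$. (Val) from $\Gamma\vdash^{w}V:\mathcal{M}$ infer $\Gamma\vdash^{w}V:\langle 1\mathcal{M}\rangle$. (!) for finite possibly empty $I$, from $\Gamma_i\vdash^{w_i}V:\mathtt{A}_i$ and scale factors $q_i$ infer $\uplus_i q_i\cdot\Gamma_i\vdash^{\sum_i q_iw_i}V:[q_i\cdot\mathtt{A}_i]_{i\in I}$. A type distribution is tight if it has the form $\langle q_k[\,]\rangle_{k\in K}$ ($K$ possibly empty); a tight typing is a derivable judgement $\vdash^{w}M:\mathtt{b}$ (empty context) with $\mathtt{b}$ tight. *)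

(* Defs.v *)
From Stdlib Require Import List SetoidPermutation.
From mathcomp Require Import all_boot all_order all_algebra reals.

Set Implicit Arguments.
Unset Strict Implicit.
Unset Printing Implicit Defensive.
Import Order.TTheory GRing.Theory Num.Theory.
Local Open Scope ring_scope.

(* Terms up to alpha-equivalence, with de Bruijn indices: Lam binds index 0 in
   its body, and Let N M (let x = N in M) binds index 0 in M. *)
Inductive value : Type :=
| Var (i : nat)
| Lam (M : term)
with term : Type :=
| Ret (V : value)
| App (V W : value)
| Oplus (M N : term)
| Let (N M : term).

Definition is_value (M : term) : bool := if M is Ret _ then true else false.

(* All free indices are smaller than n. *)
Fixpoint scopedV (n : nat) (V : value) : bool :=
  match V with
  | Var i => (i < n)%N
  | Lam M => scoped n.+1 M
  end
with scoped (n : nat) (M : term) : bool :=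
  match M with
  | Ret V => scopedV n V
  | App V W => scopedV n V && scopedV n W
  | Oplus M N => scoped n M && scoped n N
  | Let N M => scoped n N && scoped n.+1 M
  end.

Definition closed_term (M : term) : bool := scoped 0 M.

(* Extension of an environment at index 0, the old indices being shifted. *)
Definition scons (T : Type) (t : T) (s : nat -> T) (i : nat) : T :=
  if i is j.+1 then s j else t.

Definition up_ren (xi : nat -> nat) : nat -> nat := scons 0%N (succn \o xi).

Fixpoint renameV (xi : nat -> nat) (V : value) : value :=
  match V with
  | Var i => Var (xi i)
  | Lam M => Lam (rename (up_ren xi) M)
  end
with rename (xi : nat -> nat) (M : term) : term :=
  match M with
  | Ret V => Ret (renameV xi V)
  | App V W => App (renameV xi V) (renameV xi W)
  | Oplus M N => Oplus (rename xi M) (rename xi N)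
  | Let N M => Let (rename xi N) (rename (up_ren xi) M)
  end.

Definition up_subst (s : nat -> value) : nat -> value :=
  scons (Var 0) (renameV succn \o s).

Fixpoint substV (s : nat -> value) (V : value) : value :=
  match V with
  | Var i => s i
  | Lam M => Lam (subst (up_subst s) M)
  end
with subst (s : nat -> value) (M : term) : term :=
  match M with
  | Ret V => Ret (substV s V)
  | App V W => App (substV s V) (substV s W)
  | Oplus M N => Oplus (subst s M) (subst s N)
  | Let N M => Let (subst s N) (subst (up_subst s) M)
  end.

(* M{V/x}, where x is index 0 *)
Definition subst0 (V : value) (M : term) : term := subst (scons V Var) M.

(* The real numbers are the elements of an arbitrary realType R.
   Multidistributions are listed in some order; P_k below does not depend on
   it.  The pair (p, M) stands for the occurrence p M. *)
Definition mdist (R : realType) : Type := seq (R * term).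

(* step R M = Some m iff M -> m; reduction is deterministic. *)
Fixpoint step (R : realType) (M : term) : option (mdist R) :=
  match M with
  | Ret _ => None
  | App V W => if V is Lam M then Some [:: (1, subst0 W M)] else None
  | Oplus M N => Some [:: (2^-1, M); (2^-1, N)]
  | Let N M =>
      if N is Ret V then Some [:: (1, subst0 V M)]
      else omap (map (fun x => (x.1, Let x.2 M))) (step R N)
  end.

Definition mscale (R : realType) (T : Type) (u : R) (s : seq (R * T)) :
  seq (R * T) := [seq (u * x.1, x.2) | x <- s].

(* The default value [::] is never used on closed terms, which reduce unless
   they are values (see closed_stepP). *)
Definition lift_term (R : realType) (M : term) : mdist R :=
  if is_value M then [:: (1, M)] else odflt [::] (step R M).

Definition lift_step (R : realType) (m : mdist R) : mdist R :=
  flatten [seq mscale x.1 (lift_term R x.2) | x <- m].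

(* the k-th element m_k of the sequence <1 M> = m_0 => m_1 => ... *)
Definition eval (R : realType) (k : nat) (M : term) : mdist R :=
  iter k (@lift_step R) [:: (1, M)].

(* P_k(M) *)
Definition prob_val (R : realType) (k : nat) (M : term) : R :=
  \sum_(x <- eval R k M | is_value x.2) x.1.

(* E_k(M) *)
Definition exp_time (R : realType) (k : nat) (M : term) : R :=
  \sum_(j < k) (1 - prob_val R j M).

Lemma closed_stepP (R : realType) (M : term) :
  closed_term M -> is_value M = ~~ isSome (step R M).
Proof.
have omapS (f : mdist R -> mdist R) o : isSome (omap f o) = isSome o by case: o.
rewrite /closed_term; elim: M => [V|V W|N _ P _|N IH P _] //=.
  by case: V.
case/andP=> cN _; move: (IH cN) => {IH}.
by case: N {cN} => [V|V W|N1 N2|N M] // H; rewrite omapS -H.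
Qed.

(* Raw types.  A pair (q, A) in an intersection type stands for q . A, and a
   pair (p, M) in a type distribution stands for p M.  Multisets are lists;
   types are identified up to aeqv, ieqv and deqv, which permute the lists at
   all depths. *)
Inductive aty (R : realType) : Type :=
| Arr (M : seq (R * aty R)) (b : seq (R * seq (R * aty R))).

Definition ity (R : realType) : Type := seq (R * aty R).
Definition dty (R : realType) : Type := seq (R * ity R).

Inductive aeqv (R : realType) : aty R -> aty R -> Prop :=
| aeqv_Arr M M' b b' :
    PermutationA (fun x y => x.1 = y.1 /\ aeqv x.2 y.2) M M' ->
    PermutationA (fun x y => x.1 = y.1 /\
      PermutationA (fun x' y' => x'.1 = y'.1 /\ aeqv x'.2 y'.2) x.2 y.2) b b' ->
    aeqv (Arr M b) (Arr M' b').

Definition ieqv (R : realType) : ity R -> ity R -> Prop :=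
  PermutationA (fun x y => x.1 = y.1 /\ aeqv x.2 y.2).
Definition deqv (R : realType) : dty R -> dty R -> Prop :=
  PermutationA (fun x y => x.1 = y.1 /\ ieqv x.2 y.2).

(* q is in (0,1] and rational *)
Definition scale_factor (R : realType) (q : R) : Prop :=
  0 < q <= 1 /\ exists r : rat, q = ratr r.

Definition dnorm (R : realType) (a : dty R) : R := \sum_(x <- a) x.1.

(* The conditions on scale factors and probabilities in the grammar of types. *)
Inductive wf_aty (R : realType) : aty R -> Prop :=
| wf_Arr M b :
    List.Forall (fun x => scale_factor x.1 /\ wf_aty x.2) M ->
    List.Forall (fun y => 0 < y.1 <= 1 /\
      List.Forall (fun x => scale_factor x.1 /\ wf_aty x.2) y.2) b ->
    dnorm b <= 1 ->
    wf_aty (Arr M b).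

Definition wf_ity (R : realType) (M : ity R) : Prop :=
  List.Forall (fun x => scale_factor x.1 /\ wf_aty x.2) M.

Inductive ty (R : realType) : Type :=
| TArr (A : aty R)
| TInt (M : ity R)
| TDist (a : dty R).

Inductive tyeqv (R : realType) : ty R -> ty R -> Prop :=
| tyeqv_Arr A A' : aeqv A A' -> tyeqv (TArr A) (TArr A')
| tyeqv_Int M M' : ieqv M M' -> tyeqv (TInt M) (TInt M')
| tyeqv_Dist a a' : deqv a a' -> tyeqv (TDist a) (TDist a').

(* Contexts are total maps on indices; those occurring in derivable judgements
   are nonempty at finitely many indices only.  The context Gamma, x : M is
   scons M Gamma. *)
Definition ctx (R : realType) : Type := nat -> ity R.

Definition ctx0 (R : realType) : ctx R := fun=> [::].
Definition ctx1 (R : realType) (i : nat) (M : ity R) : ctx R :=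
  fun j => if j == i then M else [::].
Definition ctxU (R : realType) (G D : ctx R) : ctx R := fun i => G i ++ D i.
Definition ctxZ (R : realType) (u : R) (G : ctx R) : ctx R :=
  fun i => mscale u (G i).
Definition ctx_sum (R : realType) (n : nat) (G : 'I_n -> ctx R) : ctx R :=
  fun i => \big[cat/[::]]_(k < n) G k i.

(* typing G w M t is the judgement G |-^w M : t.
   Probabilities p_k in type distributions are real numbers while scale factors
   and weights are rational, so ty_Let requires the weight of its conclusion to
   be rational and the p_k . Delta_k to have rational scale factors.  In all
   the other rules these conditions, and the well-formedness of types, are
   inherited from the premises or imposed where a new type or a new scale
   factor appears (ty_Var, ty_Bang).
   ty_Conv accounts for types and contexts being built from multisets. *)
Inductive typing (R : realType) : ctx R -> rat -> term -> ty R -> Prop :=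
| ty_Var i M :
    wf_ity M ->
    typing (ctx1 i M) 0 (Ret (Var i)) (TInt M)
| ty_Zero M :
    typing (ctx0 R) 0 M (TDist [::])
| ty_App G D w v V W M b :
    typing G w (Ret V) (TInt [:: (1, Arr M b)]) ->
    typing D v (Ret W) (TInt M) ->
    typing (ctxU G D) (w + v) (App V W) (TDist b)
| ty_Oplus G D w v M N a b :
    typing G w M (TDist a) ->
    typing D v N (TDist b) ->
    typing (ctxU (ctxZ 2^-1 G) (ctxZ 2^-1 D)) (2^-1 * w + 2^-1 * v + 1)
      (Oplus M N) (TDist (mscale 2^-1 a ++ mscale 2^-1 b))
| ty_Lam G w T M b :
    typing (scons M G) w T (TDist b) ->
    typing G (w + 1) (Ret (Lam T)) (TArr (Arr M b))
| ty_Let n G v N T (p : 'I_n -> R) (M : 'I_n -> ity R)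
    (D : 'I_n -> ctx R) (w : 'I_n -> rat) (b : 'I_n -> dty R) (w' : rat) :
    typing G v N (TDist [seq (p k, M k) | k : 'I_n]) ->
    (forall k, typing (scons (M k) (D k)) (w k) T (TDist (b k))) ->
    (forall k i, wf_ity (ctxZ (p k) (D k) i)) ->
    ratr w' = \sum_(k < n) p k * ratr (w k) + ratr v + 1 ->
    typing (ctxU G (ctx_sum (fun k => ctxZ (p k) (D k)))) w' (Let N T)
      (TDist (\big[cat/[::]]_(k < n) mscale (p k) (b k)))
| ty_Val G w V M :
    typing G w (Ret V) (TInt M) ->
    typing G w (Ret V) (TDist [:: (1, M)])
| ty_Bang n V (q : 'I_n -> rat) (G : 'I_n -> ctx R) (w : 'I_n -> rat)
    (A : 'I_n -> aty R) :
    (forall i, 0 < q i <= 1) ->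
    (forall i, typing (G i) (w i) (Ret V) (TArr (A i))) ->
    typing (ctx_sum (fun i => ctxZ (ratr (q i)) (G i)))
      (\sum_(i < n) q i * w i) (Ret V)
      (TInt [seq (ratr (q i), A i) | i : 'I_n])
| ty_Conv G G' w M t t' :
    (forall i, ieqv (G i) (G' i)) ->
    tyeqv t t' ->
    typing G w M t ->
    typing G' w M t'.

Definition tight (R : realType) (b : dty R) : bool := all (fun x => nilp x.2) b.

(* Main.v *)
Require Import Defs.
From Stdlib Require Import SetoidPermutation.
From mathcomp Require Import all_boot all_order all_algebra reals boolp.
From mathcomp Require Import ring lra.
Import Order.TTheory GRing.Theory Num.Theory.
Local Open Scope ring_scope.

Set Implicit Arguments.
Unset Strict Implicit.
Unset Printing Implicit Defensive.

(* The proof is by realizability, biorthogonal with respect to let-stacks: a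
   term realizes a type distribution b with weight w if, in every stack K of
   let-contexts, the bounds on P_k and E_k available when K is filled with
   realizers of the components of b average to bounds for K filled with the
   term, the expected time being increased by w.  Weights are additive, so the
   counts of steps made by every typing rule match those of the reduction, and
   induction on typing shows that typable terms are realizers.  In the empty
   stack every value is a realizer of the empty intersection type with
   weight 0, hence a tight type yields the two inequalities. *)

Scheme value_mind := Induction for value Sort Prop
  with term_mind := Induction for term Sort Prop.
Combined Scheme value_term_ind from value_mind, term_mind.

(** * Substitution *)

Lemma up_ren_comp (xi ze : nat -> nat) :
  up_ren xi \o up_ren ze = up_ren (xi \o ze).
Proof. by apply: funext => -[]. Qed.

Lemma rename_rename :
  (forall V xi ze, renameV xi (renameV ze V) = renameV (xi \o ze) V) /\
  (forall M xi ze, rename xi (rename ze M) = rename (xi \o ze) M).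
Proof.
apply: value_term_ind => //=.
- by move=> M IH xi ze; rewrite IH up_ren_comp.
- by move=> V IH xi ze; rewrite IH.
- by move=> V IHV W IHW xi ze; rewrite IHV IHW.
- by move=> M IHM N IHN xi ze; rewrite IHM IHN.
- by move=> N IHN M IHM xi ze; rewrite IHN IHM up_ren_comp.
Qed.

Lemma up_subst_ren s xi : up_subst s \o up_ren xi = up_subst (s \o xi).
Proof. by apply: funext => -[]. Qed.

Lemma subst_rename :
  (forall V s xi, substV s (renameV xi V) = substV (s \o xi) V) /\
  (forall M s xi, subst s (rename xi M) = subst (s \o xi) M).
Proof.
apply: value_term_ind => //=.
- by move=> M IH s xi; rewrite IH up_subst_ren.
- by move=> V IH s xi; rewrite IH.
- by move=> V IHV W IHW s xi; rewrite IHV IHW.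
- by move=> M IHM N IHN s xi; rewrite IHM IHN.
- by move=> N IHN M IHM s xi; rewrite IHN IHM up_subst_ren.
Qed.

Lemma up_ren_subst s xi :
  renameV (up_ren xi) \o up_subst s = up_subst (renameV xi \o s).
Proof. by apply: funext => -[|i] //=; rewrite !(proj1 rename_rename). Qed.

Lemma rename_subst :
  (forall V s xi, renameV xi (substV s V) = substV (renameV xi \o s) V) /\
  (forall M s xi, rename xi (subst s M) = subst (renameV xi \o s) M).
Proof.
apply: value_term_ind => //=.
- by move=> M IH s xi; rewrite IH up_ren_subst.
- by move=> V IH s xi; rewrite IH.
- by move=> V IHV W IHW s xi; rewrite IHV IHW.
- by move=> M IHM N IHN s xi; rewrite IHM IHN.
- by move=> N IHN M IHM s xi; rewrite IHN IHM up_ren_subst.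
Qed.

Lemma up_subst_comp s t : substV (up_subst t) \o up_subst s = up_subst (substV t \o s).
Proof.
apply: funext => -[|i] //=.
by rewrite (proj1 subst_rename) (proj1 rename_subst).
Qed.

Lemma subst_subst :
  (forall V s t, substV t (substV s V) = substV (substV t \o s) V) /\
  (forall M s t, subst t (subst s M) = subst (substV t \o s) M).
Proof.
apply: value_term_ind => //=.
- by move=> M IH s t; rewrite IH up_subst_comp.
- by move=> V IH s t; rewrite IH.
- by move=> V IHV W IHW s t; rewrite IHV IHW.
- by move=> M IHM N IHN s t; rewrite IHM IHN.
- by move=> N IHN M IHM s t; rewrite IHN IHM up_subst_comp.
Qed.

Lemma up_subst_Var : up_subst Var = Var.
Proof. by apply: funext => -[]. Qed.

Lemma subst_Var :
  (forall V, substV Var V = V) /\ (forall M, subst Var M = M).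
Proof.
by apply: value_term_ind => //= *; rewrite ?up_subst_Var; congruence.
Qed.

(** Contracting a redex whose body already carries the environment [s] amounts to extending [s] with
    the argument; binders are treated in this way in the induction on typing. *)
Lemma subst0_up W s M : subst0 W (subst (up_subst s) M) = subst (scons W s) M.
Proof.
rewrite /subst0 (proj2 subst_subst); congr (subst _ M).
apply: funext => -[|i] //=.
by rewrite (proj1 subst_rename) (_ : _ \o _ = Var) ?(proj1 subst_Var).
Qed.

(** * Evaluation *)

(** The head of [K] is the innermost let, so [Let N T] in the stack [K] is [N] in the stack
    [T :: K]. *)
Fixpoint plug (K : seq term) (N : term) : term :=
  if K is T :: K' then plug K' (Let N T) else N.

Section Evaluation.
Variable R : realType.
Implicit Types (M N T : term) (K : seq term) (m : mdist R).

Lemma step_Let N T : ~~ is_value N ->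
  step R (Let N T) = omap (map (fun x => (x.1, Let x.2 T))) (step R N).
Proof. by case: N. Qed.

Lemma step_plug K M : ~~ is_value M ->
  step R (plug K M) = omap (map (fun x => (x.1, plug K x.2))) (step R M).
Proof.
elim: K M => [|T K IH] M nv /=.
  by case: (step R M) => //= m; congr Some; elim: m => //= -[? ?] m <-.
rewrite IH // step_Let //; case: (step R M) => //= m.
by rewrite -map_comp.
Qed.

Lemma plug_value K M : is_value (plug K M) = nilp K && is_value M.
Proof. by elim: K M => //= T K IH M; rewrite IH andbF. Qed.

Lemma step_sum M m : step R M = Some m ->
  all (fun x => 0 <= x.1) m /\ \sum_(x <- m) x.1 = 1.
Proof.
elim: M m => [V|V W|M _ N _|N IHN T _] m //=.
- by case: V => // M [<-]; rewrite big_seq1 /= ler01.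
- case=> <-; rewrite !big_cons big_nil /= invr_ge0 ler0n; split=> //; lra.
- case: N IHN => [V _ [<-]|V W|M1 M2|N M]; first by rewrite big_seq1 /= ler01.
  all: case: (step R _) => //= m' /(_ _ erefl)[m0 m1] [<-].
  all: by rewrite all_map big_map.
Qed.

(** Only an inequality for the mass, since stuck open terms lift to the empty multidistribution. *)
Lemma lift_term_sum M :
  all (fun x => 0 <= x.1) (lift_term R M) /\ \sum_(x <- lift_term R M) x.1 <= 1.
Proof.
rewrite /lift_term; case: ifP => _; first by rewrite big_seq1 /= ler01.
case E: (step R M) => [m|] /=; last by rewrite big_nil ler01.
by have [? ->] := step_sum E.
Qed.

(** * Termination probability and expected time *)

Lemma prob_val0 M : prob_val R 0 M = (is_value M)%:R.
Proof. by rewrite /prob_val /eval /= big_mkcond big_seq1 /=; case: ifP. Qed.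

Lemma prob_val_linear k m :
  \sum_(x <- iter k (@lift_step R) m | is_value x.2) x.1 =
  \sum_(x <- m) x.1 * prob_val R k x.2.
Proof.
elim: k m => [|k IH] m.
  by rewrite big_mkcond; apply: eq_bigr => x _; rewrite prob_val0 mulr_natr mulrb.
(* This is [prob_valS] at [k], for which the induction hypothesis suffices. *)
have PS M : prob_val R k.+1 M = \sum_(x <- lift_term R M) x.1 * prob_val R k x.2.
  rewrite /prob_val /eval iterSr IH /lift_step /= cats0 /mscale big_map.
  by apply: eq_bigr => x _; rewrite mul1r.
rewrite iterSr IH big_flatten big_map; apply: eq_bigr => x _.
rewrite PS mulr_sumr big_map; apply: eq_bigr => y _ /=.
by rewrite mulrA.
Qed.

(** Evaluation is linear in the multidistribution, so the first step can be split off and the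
    remaining [k] steps averaged over its reducts. *)
Lemma prob_valS k M :
  prob_val R k.+1 M = \sum_(x <- lift_term R M) x.1 * prob_val R k x.2.
Proof.
rewrite {1}/prob_val /eval iterSr prob_val_linear /lift_step /= cats0 big_map.
by apply: eq_bigr => x _; rewrite mul1r.
Qed.

Lemma ler_wavg m (f g : term -> R) : all (fun x => 0 <= x.1) m ->
  (forall M, f M <= g M) ->
  \sum_(x <- m) x.1 * f x.2 <= \sum_(x <- m) x.1 * g x.2.
Proof.
move=> m0 fg; elim: m m0 => [|x m IH] /=; first by rewrite !big_nil.
by case/andP=> x0 /IH le_m; rewrite !big_cons lerD // ler_wpM2l.
Qed.

Lemma prob_val_ge0 k M : 0 <= prob_val R k M.
Proof.
elim: k M => [|k IH] M; first by rewrite prob_val0 ler0n.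
rewrite prob_valS.
apply: le_trans (ler_wavg (proj1 (lift_term_sum M)) IH).
by rewrite big1 // => x _; rewrite mulr0.
Qed.

Lemma prob_val_le1 k M : prob_val R k M <= 1.
Proof.
elim: k M => [|k IH] M; first by rewrite prob_val0 lern1; case: is_value.
have [m0] := lift_term_sum M; apply: le_trans.
rewrite prob_valS; apply: le_trans (ler_wavg m0 IH) _.
by under eq_bigr do rewrite mulr1.
Qed.

Lemma prob_val_homo M : {homo (prob_val R)^~ M : k l / (k <= l)%N >-> k <= l}.
Proof.
apply: homo_leq => [//|? ? ?|k]; first exact: le_trans.
elim: k M => [|k IH] M.
  rewrite prob_val0; case: (boolP (is_value M)) => [|_]; last exact: prob_val_ge0.
  by case: M => // V _; rewrite prob_valS big_seq1 mul1r prob_val0.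
rewrite prob_valS [leRHS]prob_valS.
exact: ler_wavg (proj1 (lift_term_sum M)) IH.
Qed.

Lemma exp_time_homo M : {homo (exp_time R)^~ M : k l / (k <= l)%N >-> k <= l}.
Proof.
apply: homo_leq => [//|? ? ?|k]; first exact: le_trans.
by rewrite [leRHS]/exp_time big_ord_recr /= lerDl subr_ge0 prob_val_le1.
Qed.

(** The term of index 0 is 1 because [M] is not a value. The reducts have total mass exactly 1, so
    the later terms [1 - prob_val R j.+1 M] are averages over them. *)
Lemma exp_timeS M m k : step R M = Some m ->
  exp_time R k.+1 M = 1 + \sum_(x <- m) x.1 * exp_time R k x.2.
Proof.
move=> sM; have [_ m1] := step_sum sM.
have nv : is_value M = false by case: M sM.
rewrite /exp_time big_ord_recl prob_val0 nv subr0; congr (1 + _).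
under [RHS]eq_bigr do rewrite mulr_sumr.
rewrite exchange_big; apply: eq_bigr => j _ /=.
rewrite prob_valS /lift_term nv sM /=.
under [RHS]eq_bigr do rewrite mulrBr mulr1.
by rewrite sumrB m1.
Qed.

(** Removing a let of the stack takes a step of its own, and steps made inside [M] leave the stack
    intact. *)
Lemma prob_val_plug j K M : (j < size K)%N -> prob_val R j (plug K M) = 0.
Proof.
elim: j K M => [|j IH] [|T K] M //= jK; first by rewrite prob_val0 plug_value andbF.
rewrite prob_valS /lift_term plug_value andbF.
case: (boolP (is_value M)) => [|nv].
  by case: M => // V _; rewrite step_plug //= big_seq1 IH ?mulr0.
rewrite step_plug // step_Let //; case: (step R M) => [m|] /=; last exact: big_nil.
rewrite big_map big_map big1 // => x _ /=.
(* The innermost let has survived the step, so the induction hypothesis is used with the full stack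
   [T :: K]. *)
by rewrite -[plug K _]/(plug (T :: K) x.2) IH ?mulr0 // ltnW.
Qed.

(** One index serves both bounds. Since both quantities grow with [k], bounds reached at different
    indices can be brought to a common one. *)
Definition obs M (r w : R) : Prop :=
  exists k, r <= prob_val R k M /\ w <= exp_time R k M.

Lemma obs_plug K M : obs (plug K M) 0 (size K)%:R.
Proof.
exists (size K); split; first exact: prob_val_ge0.
rewrite /exp_time (eq_bigr (fun=> 1)) ?sumr_const ?card_ord // => j _.
by rewrite prob_val_plug // subr0.
Qed.

Lemma obs_value V : obs (Ret V) 1 0.
Proof. by exists 0%N; rewrite prob_val0 /exp_time big_ord0. Qed.

End Evaluation.

(** * Weighted sums *)

Section WeightedSum.
Variables (R : pzRingType) (L : lmodType R) (T : Type) (Q : T -> L -> Prop).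

(** [Q] relates an element to its admissible weights, and each occurrence chooses its own. The
    module [L] is [R^o] for weights of realizers and [R^o * R^o] for pairs of bounds. Structural
    recursion with [Q] as a fixed parameter allows [raty] to call itself through [wsum]. *)
Fixpoint wsum (l : seq (R * T)) (w : L) : Prop :=
  match l with
  | [::] => w = 0
  | (q, x) :: l' => exists u v, [/\ Q x u, wsum l' v & w = q *: u + v]
  end.

Lemma wsum1 q x w : wsum [:: (q, x)] w <-> exists2 u, Q x u & w = q *: u.
Proof.
split=> [[u [v [Qu -> ->]]]|[u Qu ->]]; first by exists u; rewrite ?addr0.
by exists u, 0; rewrite addr0.
Qed.

Lemma wsum_cat l1 l2 w : wsum (l1 ++ l2) w <->
  exists w1 w2, [/\ wsum l1 w1, wsum l2 w2 & w = w1 + w2].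
Proof.
elim: l1 w => [|[q x] l1 IH] w /=.
  split=> [Hw|[_ [w2 [-> H2 ->]]]]; last by rewrite add0r.
  by exists 0, w; rewrite add0r.
split.
  case=> u [_ [Qu /IH[w1 [w2 [H1 H2 ->]]] ->]].
  by exists (q *: u + w1), w2; split; [exists u, w1 | | rewrite addrA].
case=> _ [w2 [[u [w1 [Qu H1 ->]]] H2 ->]].
exists u, (w1 + w2); split=> //; last by rewrite addrA.
by apply/IH; exists w1, w2.
Qed.

Lemma wsum_bigcat n (F : 'I_n -> seq (R * T)) w :
  wsum (\big[cat/[::]]_(k < n) F k) w <->
  exists2 f : 'I_n -> L, forall k, wsum (F k) (f k) & w = \sum_k f k.
Proof.
elim: n F w => [|n IH] F w.
  rewrite big_ord0 /=; split=> [->|[f _ ->]]; last by rewrite big_ord0.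
  by exists (fun=> 0) => [[]|]; rewrite ?big_ord0.
rewrite big_ord_recl wsum_cat; split.
  case=> w1 [_ [H1 /IH[f Hf ->] ->]].
  exists (fun k => if unlift ord0 k is Some j then f j else w1).
    by move=> k; case: unliftP => [j|] ->.
  rewrite big_ord_recl unlift_none; congr (_ + _).
  by apply: eq_bigr => j _; rewrite liftK.
case=> f Hf ->; exists (f ord0), (\sum_j f (lift ord0 j)).
split=> //; last by rewrite big_ord_recl.
by apply/IH; exists (fun j => f (lift ord0 j)).
Qed.

Lemma wsum_codom n (q : 'I_n -> R) (x : 'I_n -> T) w :
  wsum [seq (q k, x k) | k : 'I_n] w <->
  exists2 f : 'I_n -> L, forall k, Q (x k) (f k) & w = \sum_k q k *: f k.
Proof.
have ->: [seq (q k, x k) | k : 'I_n] = \big[cat/[::]]_k [:: (q k, x k)].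
  rewrite /image_mem [index_enum _]unlock -enumT.
  by elim: (enum _) => [|k s IH]; rewrite ?big_nil // big_cons /= IH.
rewrite wsum_bigcat; split=> -[f Hf ->].
  have /choice[g Hg]: forall k, exists u, Q (x k) u /\ f k = q k *: u.
    by move=> k; have /wsum1[u Qu fu] := Hf k; exists u.
  by exists g => [k|]; [case: (Hg k) | apply: eq_bigr => k _; case: (Hg k)].
by exists (fun k => q k *: f k) => // k; apply/wsum1; exists (f k).
Qed.

End WeightedSum.

Lemma wsum_scale (R : realType) (L : lmodType R) (T : Type)
    (Q : T -> L -> Prop) q (l : seq (R * T)) w :
  wsum Q (mscale q l) w <-> exists2 u, wsum Q l u & w = q *: u.
Proof.
elim: l w => [|[p x] l IH] w /=.
  by split=> [->|[_ -> ->]]; [exists 0 => //; rewrite scaler0 | rewrite scaler0].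
split.
  case=> u [_ [Qu /IH[v Hv ->] ->]].
  by exists (p *: u + v); [exists u, v | rewrite scalerDr scalerA].
case=> _ [u [v [Qu Hv ->]] ->].
exists u, (q *: v); split=> //; last by rewrite scalerDr scalerA.
by apply/IH; exists v.
Qed.

Lemma wsum_perm (R : pzRingType) (L : lmodType R) (T : Type)
    (Q : T -> L -> Prop) (l l' : seq (R * T)) :
  PermutationA (fun x y => x.1 = y.1 /\ forall u, Q x.2 u <-> Q y.2 u) l l' ->
  forall w, wsum Q l w <-> wsum Q l' w.
Proof.
elim=> {l l'} [|[q x] [q' y] l l' /= [-> E] _ IH|[q x] [q' y] l|l1 l2 l3 _ IH1 _ IH2] w.
- by [].
- by split=> -[u [v [/E Qu /IH H ->]]]; exists u, v.
- split=> -[u [_ [Qu [u' [v [Qu' H ->]]] ->]]]; rewrite addrCA.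
    by exists u', (q' *: u + v); split=> //; exists u, v.
  by exists u', (q *: u + v); split=> //; exists u, v.
- by rewrite IH1.
Qed.

(** The explicit [fix] with [sub] as parameter and the transparent ending let the guard checker see
    through this lemma in [aeqv_nested_ind]. *)
Lemma PermutationA_sub (T : Type) (E E' : T -> T -> Prop) :
  (forall x y, E x y -> E' x y) ->
  forall l l', PermutationA E l l' -> PermutationA E' l l'.
Proof.
move=> sub; fix F 3 => _ _ [|x y l l' /sub xy /F ll'|x y l|l1 l2 l3 /F H1 /F H2].
- exact: permA_nil.
- exact: permA_skip.
- exact: permA_swap.
- exact: permA_trans H1 H2.
Defined.

Lemma PermutationA_size (T : Type) (E : T -> T -> Prop) l l' :
  PermutationA E l l' -> size l = size l'.
Proof. by elim=> //= [? ? ? ? _ _ ->|? ? ? _ -> _ ->]. Qed.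

Lemma PermutationA_sum (R : realType) (T : Type)
    (E : R * T -> R * T -> Prop) (l l' : seq (R * T)) :
  (forall x y, E x y -> x.1 = y.1) -> PermutationA E l l' ->
  \sum_(x <- l) x.1 = \sum_(x <- l') x.1.
Proof.
move=> E1; elim=> [//|x y l1 l2 /E1 xy _ IH|x y l1|l1 l2 l3 _ -> _ //].
  by rewrite !big_cons xy IH.
by rewrite !big_cons addrCA.
Qed.

(* The generated induction principle ignores the occurrences of [aeqv] under
   [PermutationA]. *)
Lemma aeqv_nested_ind (R : realType) (P : aty R -> aty R -> Prop) :
  (forall M M' b b',
    PermutationA (fun x y => x.1 = y.1 /\ P x.2 y.2) M M' ->
    PermutationA (fun x y => x.1 = y.1 /\
      PermutationA (fun x' y' => x'.1 = y'.1 /\ P x'.2 y'.2) x.2 y.2) b b' ->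
    P (Arr M b) (Arr M' b')) ->
  forall A A', aeqv A A' -> P A A'.
Proof.
move=> PArr; fix F 3 => A A' [M M' b b' hM hb]; apply: PArr.
  by apply: PermutationA_sub hM => x y [e a]; split=> //; apply: F.
apply: PermutationA_sub hb => x y [e h]; split=> //.
by apply: PermutationA_sub h => x' y' [e' a]; split=> //; apply: F.
Qed.

(** * Realizability *)

Section Realizability.
Variable R : realType.
Implicit Types (M N : term) (V W : value) (K : seq term) (w : R).

Lemma obs_step M (m : mdist R) (z : R^o * R^o) : step R M = Some m ->
  wsum (fun N (z : R^o * R^o) => obs N z.1 z.2) m z -> obs M z.1 (1 + z.2).
Proof.
move=> sM Hz; have [m0 _] := step_sum sM.
have [k [k1 k2]]: exists k,
    z.1 <= \sum_(x <- m) x.1 * prob_val R k x.2 /\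
    z.2 <= \sum_(x <- m) x.1 * exp_time R k x.2.
  elim: m z m0 Hz {sM} => [|[p N] m IH] z /=.
    by move=> _ ->; exists 0%N; rewrite !big_nil.
  case/andP=> p0 m0 [u [v [[k1 [H1 H2]] /(IH _ m0)[k2 [H3 H4]] ->]]].
  (* The reducts reach their bounds at different indices; by monotonicity the maximum serves all of
     them. *)
  exists (maxn k1 k2); rewrite !big_cons; split; apply: lerD.
  - by apply: ler_wpM2l => //; apply: (le_trans H1); apply/prob_val_homo/leq_maxl.
  - apply: (le_trans H3); apply: ler_wavg => // M'.
    exact/prob_val_homo/leq_maxr.
  - by apply: ler_wpM2l => //; apply: (le_trans H2); apply/exp_time_homo/leq_maxl.
  - apply: (le_trans H4); apply: ler_wavg => // M'.
    exact/exp_time_homo/leq_maxr.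
exists k.+1; rewrite (exp_timeS _ sM) lerD2l prob_valS /lift_term sM /=.
by case: M sM.
Qed.

Lemma obs_step1 M N (r w : R) : step R M = Some [:: (1, N)] ->
  obs N r w -> obs M r (1 + w).
Proof.
move=> sM H; apply: (@obs_step _ _ (r, w) sM); apply/wsum1; exists (r, w) => //.
by rewrite scale1r.
Qed.

Lemma obs_Oplus K M N (r1 w1 r2 w2 : R) :
  obs (plug K M) r1 w1 -> obs (plug K N) r2 w2 ->
  obs (plug K (Oplus M N)) (2^-1 * r1 + 2^-1 * r2) (1 + (2^-1 * w1 + 2^-1 * w2)).
Proof.
move=> H1 H2.
apply: (@obs_step _ _ (2^-1 * r1 + 2^-1 * r2, 2^-1 * w1 + 2^-1 * w2)).
  by rewrite step_plug.
exists (r1, w1), (2^-1 *: ((r2, w2) : R^o * R^o)); split=> //.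
by apply/wsum1; exists (r2, w2).
Qed.

(* [z] bounds from below what can be observed of a let-stack [K] filled with
   the values described by [b]: z.1 for the probability of termination, z.2
   for the number of steps, not counting the weights of these values. *)
Definition stack_bound (T : Type) (Q : T -> value -> R^o -> Prop)
    (K : seq term) (b : seq (R * T)) (z : R^o * R^o) : Prop :=
  wsum (fun x (z : R^o * R^o) => forall V v, Q x V v -> obs (plug K (Ret V)) z.1 (v + z.2)) b z.

(* Runs of M that do not reach a value described by b still pay at least one
   step for every let of the stack; hence the last summand. *)
Definition rdist (T : Type) (Q : T -> value -> R^o -> Prop)
    (b : seq (R * T)) (M : term) (w : R) : Prop :=
  forall K z, stack_bound Q K b z ->
  obs (plug K M) z.1 (w + z.2 + (1 - \sum_(x <- b) x.1) * (size K)%:R).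

(** The weight of an arrow includes the beta-step, through the [w + 1] of [ty_Lam]; the contractum
    is therefore left with one less. The inner function is [rity], inlined because the two are
    mutually dependent. *)
Fixpoint raty (A : aty R) (V : value) (w : R^o) {struct A} : Prop :=
  let: Arr M b := A in
  exists2 T, V = Lam T & forall W v, wsum (fun A' => raty A' W) M v ->
    rdist (fun (C : ity R) V' => wsum (fun A' => raty A' V') C) b (subst0 W T) (w + v - 1).

Definition rity (M : ity R) (V : value) (w : R^o) : Prop :=
  wsum (fun A => raty A V) M w.

Definition rty (t : ty R) (M : term) (w : R) : Prop :=
  match t with
  | TArr A => exists2 V, M = Ret V & raty A V w
  | TInt C => exists2 V, M = Ret V & rity C V w
  | TDist b => rdist rity b M w
  end.

Lemma rdist_perm (T : Type) (Q : T -> value -> R^o -> Prop) (b b' : seq (R * T)) :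
  PermutationA (fun x y => x.1 = y.1 /\ forall V v, Q x.2 V v <-> Q y.2 V v) b b' ->
  forall M w, rdist Q b M w <-> rdist Q b' M w.
Proof.
move=> bb' M w.
have Hs : \sum_(x <- b) x.1 = \sum_(x <- b') x.1.
  by apply: PermutationA_sum bb' => x y [].
have HK K z : stack_bound Q K b z <-> stack_bound Q K b' z.
  apply: wsum_perm; apply: PermutationA_sub bb' => x y [e h]; split=> // u.
  by split=> H V v /h; apply: H.
by rewrite /rdist Hs; split=> H K z /HK; apply: H.
Qed.

Lemma raty_aeqv (A A' : aty R) : aeqv A A' ->
  forall V w, raty A V w <-> raty A' V w.
Proof.
elim/aeqv_nested_ind=> {A A'} M M' b b' hM hb V w /=.
have EM W v : wsum (fun A' => raty A' W) M v <-> wsum (fun A' => raty A' W) M' v.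
  by apply: wsum_perm; apply: PermutationA_sub hM => x y [e h]; split.
have Eb : forall N u, rdist rity b N u <-> rdist rity b' N u.
  apply: rdist_perm; apply: PermutationA_sub hb => x y [e h]; split=> // V' v.
  by apply: wsum_perm; apply: PermutationA_sub h => x' y' [e' h']; split.
by split=> -[T -> H]; exists T => // W v /EM /H /Eb.
Qed.

Lemma rity_ieqv (M M' : ity R) : ieqv M M' -> forall V w, rity M V w <-> rity M' V w.
Proof.
move=> MM' V w; apply: wsum_perm; apply: PermutationA_sub MM' => x y [e h].
by split=> // u; apply: raty_aeqv.
Qed.

Lemma rty_tyeqv (t t' : ty R) M w : tyeqv t t' -> rty t M w -> rty t' M w.
Proof.
case=> [A A' /raty_aeqv E [V -> /E]|M' M'' /rity_ieqv E [V -> /E]|a a' E] /=.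
- by exists V.
- by exists V.
apply: (proj1 (rdist_perm _ _ _)); apply: PermutationA_sub E => x y [e h].
by split=> //; apply: rity_ieqv.
Qed.

(** * Environments of realizers *)

(** The weight [w] is the total over all variables. It is a finite sum because an empty intersection
    type is realized with weight 0 only. *)
Definition renv (s : nat -> value) (G : ctx R) (w : R) : Prop :=
  exists (n : nat) (v : nat -> R), [/\ forall i, (n <= i)%N -> G i = [::],
    forall i, rity (G i) (s i) (v i) & w = \sum_(i < n) v i].

Lemma renv_ctx0 s : renv s (@ctx0 R) 0.
Proof. by exists 0%N, (fun=> 0); rewrite big_ord0. Qed.

Lemma renv_ctx1 s i C w : renv s (ctx1 i C) w -> rity C (s i) w.
Proof.
case=> n [v [G0 Hv ->]].
have v0 j : j != i -> v j = 0 by move=> /negPf ji; have := Hv j; rewrite /ctx1 ji.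
have [ni|ni] := leqP n i.
  have := G0 i ni; rewrite /ctx1 eqxx => ->.
  by apply: big1 => j _; apply: v0; rewrite neq_ltn (leq_trans (ltn_ord j) ni).
rewrite (bigD1 (Ordinal ni)) //= big1 ?addr0; last first.
  by move=> j ji; apply: v0.
by have := Hv i; rewrite /ctx1 eqxx.
Qed.

Lemma renv_scons s V C v G w : rity C V v -> renv s G w ->
  renv (scons V s) (scons C G) (v + w).
Proof.
move=> HC [n [u [G0 Hu ->]]]; exists n.+1, (scons v u); split.
- by case=> // i /G0.
- by case.
- by rewrite big_ord_recl.
Qed.

(** This lemma and the next two invert the way the rules build contexts: weights are additive over
    unions and homogeneous under scaling, so the weight of an environment is shared out among the
    premises. *)
Lemma renv_ctxU s G D w : renv s (ctxU G D) w ->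
  exists w1 w2, [/\ renv s G w1, renv s D w2 & w = w1 + w2].
Proof.
case=> n [v [G0 Hv ->]].
have /choice[f Hf]: forall i, exists x : R * R,
    [/\ rity (G i) (s i) x.1, rity (D i) (s i) x.2 & v i = x.1 + x.2].
  by move=> i; have /wsum_cat[a [b H]] := Hv i; exists (a, b).
exists (\sum_(i < n) (f i).1), (\sum_(i < n) (f i).2).
rewrite -big_split; split.
- exists n, (fun i => (f i).1); split=> // i; last by case: (Hf i).
  by move/G0; rewrite /ctxU; case: (G i).
- exists n, (fun i => (f i).2); split=> // i; last by case: (Hf i).
  by move/G0; rewrite /ctxU; case: (G i).
- by apply: eq_bigr => i _; case: (Hf i).
Qed.

Lemma renv_ctxZ s u G w : renv s (ctxZ u G) w ->
  exists2 w', renv s G w' & w = u * w'.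
Proof.
case=> n [v [G0 Hv ->]].
have /choice[f Hf]: forall i, exists x, rity (G i) (s i) x /\ v i = u * x.
  by move=> i; have /wsum_scale[a H ->] := Hv i; exists a.
exists (\sum_(i < n) f i); last first.
  by rewrite mulr_sumr; apply: eq_bigr => i _; case: (Hf i).
exists n, f; split=> // i; last by case: (Hf i).
by move/G0; rewrite /ctxZ /mscale; case: (G i).
Qed.

Lemma renv_ctx_sum s n (D : 'I_n -> ctx R) w : renv s (ctx_sum D) w ->
  exists2 f : 'I_n -> R, forall k, renv s (D k) (f k) & w = \sum_k f k.
Proof.
case=> m [v [G0 Hv ->]].
have /choice[f Hf]: forall i, exists x : 'I_n -> R,
    (forall k, rity (D k i) (s i) (x k)) /\ v i = \sum_k x k.
  by move=> i; have /wsum_bigcat[a H ->] := Hv i; exists a.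
exists (fun k => \sum_(i < m) f i k); last first.
  by rewrite exchange_big; apply: eq_bigr => i _; case: (Hf i).
move=> k; exists m, (f^~ k); split=> // i; last by case: (Hf i).
(* Sizes add up, so an empty concatenation has only empty parts. *)
move/G0/(congr1 size); rewrite /ctx_sum (big_morph size (@size_cat _) erefl).
move=> /eqP; rewrite sum_nat_eq0 => /forallP/(_ k) /=.
by move/nilP.
Qed.

Lemma renv_ieqv s (G G' : ctx R) w :
  (forall i, ieqv (G i) (G' i)) -> renv s G' w -> renv s G w.
Proof.
move=> E [n [v [G0 Hv ->]]]; exists n, v; split=> // i.
  by move/G0 => Gi; apply: size0nil; rewrite (PermutationA_size (E i)) Gi.
exact/(rity_ieqv (E i)).
Qed.

(** * Realizability of the typing rules *)

Lemma sum_mscale (T : Type) (u : R) (b : seq (R * T)) :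
  \sum_(x <- mscale u b) x.1 = u * \sum_(x <- b) x.1.
Proof. by rewrite big_map mulr_sumr. Qed.

Lemma sum_bigcat (T : Type) n (b : 'I_n -> seq (R * T)) :
  \sum_(x <- \big[cat/[::]]_k b k) x.1 = \sum_k \sum_(x <- b k) x.1.
Proof.
pose f (l : seq (R * T)) := \sum_(x <- l) x.1.
apply: (big_morph f); first by move=> l1 l2; rewrite /f big_cat.
by rewrite /f big_nil.
Qed.

(** For the rule (Zero): only [size K] steps are claimed, and no value can appear in the stack
    before them. *)
Lemma rdist_nil (T : Type) (Q : T -> value -> R^o -> Prop) M : rdist Q [::] M 0.
Proof.
move=> K z /= ->; rewrite big_nil subr0 mul1r !add0r; exact: obs_plug.
Qed.

Lemma rdist_value (T : Type) (Q : T -> value -> R^o -> Prop) x V w :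
  Q x V w -> rdist Q [:: (1, x)] (Ret V) w.
Proof.
move=> QV K z /wsum1[u Hu ->]; rewrite big_seq1 subrr mul0r addr0 scale1r.
exact: Hu.
Qed.

Lemma rdist_step1 (T : Type) (Q : T -> value -> R^o -> Prop) b M N w :
  step R M = Some [:: (1, N)] -> rdist Q b N w -> rdist Q b M (1 + w).
Proof.
move=> sM H K z /H; rewrite -!addrA; apply: obs_step1.
by rewrite step_plug ?sM //; case: M sM.
Qed.

(** The stack summand of [rdist] is affine in the mass, so the average of those of [a] and [b] is
    the one of the combined distribution. *)
Lemma rdist_Oplus (T : Type) (Q : T -> value -> R^o -> Prop) a b M N w v :
  rdist Q a M w -> rdist Q b N v ->
  rdist Q (mscale 2^-1 a ++ mscale 2^-1 b) (Oplus M N)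
    (2^-1 * w + 2^-1 * v + 1).
Proof.
move=> HM HN K z /wsum_cat[_ [_ [/wsum_scale[z1 H1 ->] /wsum_scale[z2 H2 ->] ->]]].
have := obs_Oplus (HM _ _ H1) (HN _ _ H2).
by rewrite big_cat !sum_mscale; congr obs; rewrite /= /GRing.scale /=; field.
Qed.

(** [N] is run in the stack [M :: K]. The step that eliminates this let is counted with mass
    [\sum_k p k] by the bounds [h k], and with the missing mass by the last summand of [rdist], as
    the stack is longer by one; together they give the full 1. *)
Lemma rdist_Let (T : Type) (Q : T -> value -> R^o -> Prop) n (p : 'I_n -> R)
    (x : 'I_n -> T) (b : 'I_n -> seq (R * T)) (u : 'I_n -> R) N M v :
  rdist Q [seq (p k, x k) | k : 'I_n] N v ->
  (forall k V w, Q (x k) V w -> rdist Q (b k) (subst0 V M) (w + u k)) ->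
  rdist Q (\big[cat/[::]]_k mscale (p k) (b k)) (Let N M)
    (\sum_k p k * u k + v + 1).
Proof.
move=> HN HM K z /wsum_bigcat[f Hf ->].
have /choice[g Hg]: forall k, exists z, stack_bound Q K (b k) z /\ f k = p k *: z.
  by move=> k; have /wsum_scale[z' H ->] := Hf k; exists z'.
pose c k := \sum_(y <- b k) y.1.
(* What a value of the k-th component yields in [M :: K]: one step to the contractum, then its bound
   in [K]. The weight of the value itself is left out, as [stack_bound] requires. *)
pose h k : R^o * R^o :=
  ((g k).1, 1 + u k + (g k).2 + (1 - c k) * (size K)%:R).
have Hh : stack_bound Q (M :: K) [seq (p k, x k) | k : 'I_n] (\sum_k p k *: h k).
  apply/wsum_codom; exists h => // k V w /HM/(_ K (g k) (proj1 (Hg k))).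
  rewrite -/(c k) /= => /(@obs_step1 (plug K (Let (Ret V) M))) H.
  rewrite (_ : w + _ = 1 + (w + u k + (g k).2 + (1 - c k) * (size K)%:R)).
    by apply: H; rewrite step_plug.
  by rewrite /=; ring.
have := HN _ _ Hh.
have pair1 (F : 'I_n -> R^o * R^o) : (\sum_k F k).1 = \sum_k (F k).1.
  by apply: (big_morph fst).
have pair2 (F : 'I_n -> R^o * R^o) : (\sum_k F k).2 = \sum_k (F k).2.
  by apply: (big_morph snd).
have Ep : \sum_(y <- [seq (p k, x k) | k : 'I_n]) y.1 = \sum_k p k.
  by rewrite big_image.
rewrite sum_bigcat Ep !pair1 !pair2 (eq_bigr (fun k => (f k).1)); last first.
  by move=> k _; case: (Hg k) => _ ->.
have Ef : \sum_k (f k).2 = \sum_k p k * (g k).2.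
  by apply: eq_bigr => k _; rewrite (proj2 (Hg k)).
have Ec : \sum_k \sum_(y <- mscale (p k) (b k)) y.1 = \sum_k p k * c k.
  by apply: eq_bigr => k _; rewrite sum_mscale.
rewrite Ef Ec; congr obs => /=.
under eq_bigr do rewrite /GRing.scale /= !mulrDr mulr1 mulrBl mul1r mulrBr mulrA.
rewrite !big_split /= sumrN -!mulr_suml -natr1; ring.
Qed.

End Realizability.

(** * Soundness of typing and the conclusion *)

(** Open terms are covered by an environment [s] of realizers, whose weight [v] is added to that of
    the derivation. *)
Lemma typing_sound (R : realType) (G : ctx R) (w : rat) (M : term) (t : ty R) :
  typing G w M t ->
  forall s v, renv s G v -> rty t (subst s M) (ratr w + v).
Proof.
elim=> {G w M t}.
- move=> i C _ s v /renv_ctx1 H; rewrite rmorph0 add0r.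
  by exists (s i).
- move=> M s _ [n [u [_ Hu ->]]]; rewrite rmorph0 add0r big1.
    exact: rdist_nil.
  by move=> i _; apply: Hu.
- move=> G D w v V W C b _ IHV _ IHW s _ /renv_ctxU[x [y [/IHV HV /IHW HW ->]]].
  case: HV => _ [<-] /wsum1[u [T /= -> HT] Ew].
  (* [c] is the weight of the contractum; the 1 subtracted in [raty] is given back by the
     beta-step. *)
  case: HW => _ [<-] /HT; set c := u + _ - 1 => /rdist_step1 H.
  rewrite (_ : _ + _ = 1 + c); first exact: H.
  by rewrite /c rmorphD /= addrACA Ew scale1r; ring.
- move=> G D w v M N a b _ IHM _ IHN s z /renv_ctxU[v1 [v2 []]].
  move=> /renv_ctxZ[x /IHM HM ->] /renv_ctxZ[y /IHN HN ->] ->.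
  have := rdist_Oplus HM HN; rewrite /= !rmorphD !rmorphM /= rmorph1 fmorphV rmorph_nat.
  by congr rdist; ring.
- move=> G w T C b _ IH s v Hv; exists (Lam (subst (up_subst s) T)) => //=.
  exists (subst (up_subst s) T) => // W u Wu; rewrite subst0_up.
  have := IH _ _ (renv_scons Wu Hv); congr rdist.
  by rewrite rmorphD /= rmorph1; ring.
- move=> n G v N T p C D w b w' _ IHN _ IHT _ Ew s z /renv_ctxU[v1 [v2 []]].
  move=> /IHN HN /renv_ctx_sum[f Hf ->] ->.
  have /choice[g Hg]: forall k, exists y, renv s (D k) y /\ f k = p k * y.
    by move=> k; have [y Hy ->] := renv_ctxZ (Hf k); exists y.
  (* The body costs, for component [k], the weight of its derivation plus its share [g k] of the
     environment. *)
  have HT k V u : rity (C k) V u ->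
      rdist (@rity R) (b k) (subst0 V (subst (up_subst s) T)) (u + (ratr (w k) + g k)).
    move=> Vu; have := IHT k _ _ (renv_scons Vu (proj1 (Hg k))).
    by rewrite /= subst0_up addrCA.
  have := rdist_Let HN HT; congr rdist.
  rewrite Ew (eq_bigr (fun k => p k * ratr (w k) + f k)); last first.
    by move=> k _; rewrite (proj2 (Hg k)) mulrDr.
  by rewrite big_split /=; ring.
- move=> G w V C _ IH s v /IH[_ [<-]]; exact: rdist_value.
- move=> n V q G w A _ _ IH s z /renv_ctx_sum[f Hf ->].
  exists (substV s V) => //; apply/wsum_codom.
  have /choice[g Hg]: forall k, exists y, renv s (G k) y /\ f k = ratr (q k) * y.
    by move=> k; have [y Hy ->] := renv_ctxZ (Hf k); exists y.
  exists (fun k => ratr (w k) + g k).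
    by move=> k; have [_ [<-]] := IH k _ _ (proj1 (Hg k)).
  rewrite rmorph_sum -big_split; apply: eq_bigr => k _.
  by rewrite (proj2 (Hg k)) rmorphM /= /GRing.scale /= mulrDr.
- move=> G G' w M t t' GG' tt' _ IH s v /(renv_ieqv GG')/IH.
  exact: rty_tyeqv.
Qed.

Lemma tight_bound (R : realType) (b : dty R) :
  tight b -> stack_bound (@rity R) [::] b (dnorm b, 0).
Proof.
rewrite /dnorm; elim: b => [|[p C] b IH] /=; first by rewrite big_nil.
(* Each component contributes the bound [(1, 0)]: a value in the empty stack has already
   terminated. *)
case/andP=> /nilP -> /IH Hb; exists (1, 0), (\sum_(x <- b) x.1, 0).
split=> //; first by move=> V v ->; rewrite add0r; apply: obs_value.
rewrite big_cons; congr pair => /=; first by rewrite /GRing.scale /= mulr1.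
by rewrite /GRing.scale /= mulr0 addr0.
Qed.

Theorem mainTheorem7 (R : realType) (M : term) (w : rat) (b : dty R)
    (hM : closed_term M) (hb : tight b)
    (hty : typing (ctx0 R) w M (TDist b)) :
  exists k : nat,
    dnorm b <= prob_val R k M /\ ratr w <= exp_time R k M.
Proof.
(* The identity environment leaves [M] unchanged, and in the empty stack the summand with [size K]
   vanishes. *)
have := typing_sound hty (renv_ctx0 R Var) [::] _ (tight_bound hb).
by rewrite /= (proj2 subst_Var) mulr0 !addr0.
Qed.
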